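(* Let $d$ be a positive integer. The group $\mathbb{Z}_4^{d+1}$ contains a reduced linking system of difference sets of size $2^{d+1}-1$, that is, a reduced $\left(2^{2d+2},\,2^d(2^{d+1}-1),\,2^d(2^d-1),\,2^{2d};\,2^{d+1}-1\right)$-linking system of difference sets, at least one of whose difference sets is not reversible.
   Context: Groups are written multiplicatively. For a group $G$ of order $v$, a subset $D\subseteq G$ with $k$ elements is a $(v,k,\lambda,n)$-difference set in $G$ if the multiset $\{d_1d_2^{-1} : d_1,d_2\in D,\ d_1\neq d_2\}$ contains every non-identity element of $G$ exactly $\lambda$ times, where $n:=k-\lambda$. A subset $S$ of $G$ is identified with the element $\sum_{s\in S}s$ of the group ring $\mathbb{Z}[G]$, and $S^{(-1)}:=\sum_{s\in S}s^{-1}$. A difference set $D$ is reversible if $D=D^{(-1)}$. For $\ell\ge 2$, a collection $\{D_1,\dots,D_\ell\}$ of size $\ell$ of $(v,k,\lambda,n)$-difference sets in $G$ is a reduced $(v,k,\lambda,n;\ell)$-linking system of difference sets in $G$ of size $\ell$ if there are integers $\mu,\nu$ such that for all distinct $i,j$ there is some $(v,k,\lambda,n)$-difference set $D(i,j)$ in $G$ (not necessarily one of the $D_r$) with $D_iD_j^{(-1)}=(\mu-\nu)D(i,j)+\nu G$ in $\mathbb{Z}[G]$. *)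

(* Defs.v *)
From HB Require Import structures.
From mathcomp Require Import all_boot all_order all_algebra all_fingroup.

Set Implicit Arguments.
Unset Strict Implicit.
Unset Printing Implicit Defensive.

Import GroupScope GRing.Theory.

(* The integral group ring Z[gT].  The alias hides the pointwise ring structure
   that [{ffun gT -> int}] may carry; addition is the pointwise one. *)
Definition zgring (gT : finGroupType) : Type := {ffun gT -> int}.

Section GroupRing.
Variable gT : finGroupType.
Implicit Types (x y : gT) (a b c : zgring gT).
Local Open Scope ring_scope.

HB.instance Definition _ := GRing.Zmodule.copy (zgring gT) {ffun gT -> int}.

Definition zgelt x : zgring gT := [ffun y => (y == x)%:R].

Definition zgmul a b : zgring gT :=
  [ffun z => \sum_(x : gT) a x * b (x^-1 * z)%g].

Lemma zgmulE a b z : zgmul a b z = \sum_(x : gT) a x * b (x^-1 * z)%g.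
Proof. by rewrite ffunE. Qed.

Lemma zgmulA : associative zgmul.
Proof.
move=> a b c; apply/ffunP=> z; rewrite !zgmulE.
transitivity (\sum_(x : gT) \sum_(y : gT)
    a x * b (x^-1 * y)%g * c (y^-1 * z)%g).
  apply: eq_bigr => x _; rewrite zgmulE mulr_sumr (reindex_inj (mulgI x^-1%g)).
  by apply: eq_bigr => y _ /=; rewrite mulrA invMg invgK !mulgA mulgK.
rewrite exchange_big; apply: eq_bigr => y _ /=.
by rewrite zgmulE mulr_suml.
Qed.

Lemma zgmul1l : left_id (zgelt 1%g) zgmul.
Proof.
move=> a; apply/ffunP=> z; rewrite zgmulE (bigD1 1%g) //= big1 => [|x /negbTE ne].
  by rewrite ffunE eqxx mul1r invg1 mul1g addr0.
by rewrite ffunE ne mul0r.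
Qed.

Lemma zgmul1r : right_id (zgelt 1%g) zgmul.
Proof.
move=> a; apply/ffunP=> z; rewrite zgmulE (bigD1 z) //= big1 => [|x ne].
  by rewrite ffunE mulVg eqxx mulr1 addr0.
by rewrite ffunE -eq_invg_mul invgK (negbTE ne) mulr0.
Qed.

Lemma zgmulDl : left_distributive zgmul +%R.
Proof.
move=> a b c; apply/ffunP=> z; rewrite zgmulE [RHS]ffunE !zgmulE -big_split /=.
by apply: eq_bigr => x _; rewrite ffunE mulrDl.
Qed.

Lemma zgmulDr : right_distributive zgmul +%R.
Proof.
move=> a b c; apply/ffunP=> z; rewrite zgmulE [RHS]ffunE !zgmulE -big_split /=.
by apply: eq_bigr => x _; rewrite ffunE mulrDr.
Qed.

HB.instance Definition _ := GRing.Zmodule_isPzRing.Build (zgring gT)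
  zgmulA zgmul1l zgmul1r zgmulDl zgmulDr.

Lemma zgeltM x y : zgelt x * zgelt y = zgelt (x * y)%g.
Proof.
apply/ffunP=> z; rewrite zgmulE (bigD1 x) //= big1 => [|t /negbTE ne].
  by rewrite !ffunE eqxx mul1r addr0 -(inj_eq (mulgI x)) mulKVg.
by rewrite ffunE ne mul0r.
Qed.

End GroupRing.

Section DifferenceSets.
Variable gT : finGroupType.
Implicit Types (D : {set gT}) (L : {set {set gT}}).
Local Open Scope ring_scope.

Definition zgset D : zgring gT := \sum_(s in D) zgelt s.

Definition zgsetV D : zgring gT := \sum_(s in D) zgelt s^-1%g.

(* The group is the whole type [gT].  The number of pairs counted below is the
   multiplicity of [g] in the multiset of quotients; [n] is compared with
   [k - lambda] in [int] to avoid truncated subtraction. *)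
Definition difference_set (v k lambda n : nat) D : Prop :=
  [/\ #|[set: gT]| = v, #|D| = k, n%:Z = k%:Z - lambda%:Z
    & forall g : gT, g != 1%g ->
      #|[set p : gT * gT | [&& p.1 \in D, p.2 \in D, p.1 != p.2
                             & (p.1 * p.2^-1)%g == g]]| = lambda].

Definition reversible D : Prop := zgset D = zgsetV D.

(* The collection is a set of sets, so that its members are pairwise distinct
   and [l] is its cardinality. *)
Definition reduced_linking_system (v k lambda n l : nat) L : Prop :=
  [/\ (2 <= l)%N, #|L| = l,
      forall D, D \in L -> difference_set v k lambda n D
    & exists mu nu : int, forall D1 D2, D1 \in L -> D2 \in L -> D1 != D2 ->
        exists2 D12 : {set gT}, difference_set v k lambda n D12
        & zgset D1 * zgsetV D2 = zgset D12 *~ (mu - nu) + zgset [set: gT] *~ nu].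

End DifferenceSets.

(* Main.v *)
Require Import Defs.
From mathcomp Require Import all_boot all_order all_algebra all_fingroup.
From mathcomp Require Import finfield ring.

Set Implicit Arguments.
Unset Strict Implicit.
Unset Printing Implicit Defensive.

Import GRing.Theory Num.Theory.
Local Open Scope ring_scope.

(** Write q = 2^(d+1), G = Z_4^(d+1), F = GF(q), and let E = 2G.  Both E and
    G/E are isomorphic to the additive group of F, so G is an extension of F by
    F: there is a projection p : G -> F with kernel E, and a coordinate
    t : G -> F that is a translation along each coset of E.  Fix a nontrivial
    additive character chi : F -> {1, -1}.  The linking system consists of

      D_a = { x | p x <> 0 and chi (a * p x * t x) = 1 },   a in F, a <> 0.

    On the coset p x = c with c <> 0, the set D_a is a translate of the
    hyperplane chi (a * c * u) = 1 of E, and each hyperplane is used exactly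
    once: this is a McFarland difference set.

    The coefficient of z in D_a D_b^(-1) is computed coset by coset.  The coset
    of c meets D_a in a translate of the hyperplane of a * c, and z D_b in a
    translate of the hyperplane of b * (c - p z).  Two different hyperplanes
    always meet in q/4 points, whatever the translates; so only the c with
    a * c = b * (c - p z) carry information, and there the contribution is q/2
    or 0 according to the value of chi on the offset of the two translates
    ([count_fibre], [corr_skew_set]).
    - If a = b, these c exist only when p z = 0; then they are all the nonzero
      c, and orthogonality of characters makes the total constant for z <> 1.
      Hence D_a is a difference set ([skew_set_difference_set]).
    - If a <> b and p z <> 0, there is exactly one such c, because F is a field:
      c = b * p z / (b - a).  The offset is again a coordinate along E, so the
      coefficient is an affine function of the indicator of a set of the same
      shape, which is thus a difference set too ([crosscorr]).

    Finally, in additive notation, - x = x - 2x, so inversion moves t x by - p x.  For x with p x = 1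
    and t x = 0 this multiplies the sign defining D_a by chi a, so D_a is not
    reversible as soon as chi a = -1. *)

(** * Coefficients in the group ring *)

Section Evaluation.

Variable gT : finGroupType.
Implicit Types (A B D : {set gT}) (z : gT).

Lemma zgsetE D z : zgset D z = (z \in D)%:R.
Proof.
rewrite /zgset sum_ffunE; under eq_bigr do rewrite ffunE.
have [zD | zND] := boolP (z \in D).
  rewrite (bigD1 z) //= eqxx big1 ?addr0 // => s /andP[_].
  by rewrite eq_sym => /negbTE->.
by rewrite big1 // => s sD; case: eqP => // zs; rewrite zs sD in zND.
Qed.

Lemma zgsetVE D z : zgsetV D z = (z^-1%g \in D)%:R.
Proof.
rewrite -zgsetE /zgset /zgsetV !sum_ffunE; apply: eq_bigr => s _.
by rewrite !ffunE eq_invg_sym eq_sym.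
Qed.

Lemma zgring_mulrzE (f : zgring gT) (k : int) z : (f *~ k) z = f z * k.
Proof.
have evalMn n : (f *+ n) z = f z *+ n.
  by elim: n => [|n IHn]; rewrite ?mulr0n ?mulrS ?[LHS]ffunE ?IHn.
case: k => n; first by rewrite -pmulrn evalMn -mulr_natr natz.
by rewrite NegzE mulrNz -pmulrn [LHS]ffunE evalMn mulrN -mulr_natr natz.
Qed.

(** The coefficient of [z] in A B^(-1). *)
Definition corr A B z : int := \sum_x (x \in A)%:R * ((z^-1 * x)%g \in B)%:R.

Lemma zgset_mulVE A B z : (zgset A * zgsetV B) z = corr A B z.
Proof.
rewrite zgmulE; apply: eq_bigr => x _.
by rewrite zgsetE zgsetVE invMg invgK.
Qed.

Lemma corr1 A : corr A A 1%g = #|A|%:R.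
Proof.
rewrite -sum1_card natr_sum [RHS]big_mkcond /=; apply: eq_bigr => x _.
by rewrite invg1 mul1g; case: (x \in A).
Qed.

(** A pair with quotient [g] is determined by its first entry [x], the second
    being [g^-1 * x]; the two differ because [g] is not the identity. *)
Lemma card_quotients A g : g != 1%g ->
  #|[set u : gT * gT | [&& u.1 \in A, u.2 \in A, u.1 != u.2
                         & (u.1 * u.2^-1)%g == g]]|%:R = corr A A g.
Proof.
move=> g1; rewrite -sum1_card natr_sum /corr.
rewrite (reindex_onto (fun x => (x, (g^-1 * x)%g)) fst) /=; last first.
  case=> x y; rewrite inE /= => /and4P[_ _ _ /eqP<-].
  by rewrite invMg invgK mulgKV.
rewrite big_mkcond /=; apply: eq_bigr => x _.
rewrite inE /= eqxx andbT invMg invgK mulKVg eqxx andbT -natrM mulnb.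
have -> : x != (g^-1 * x)%g.
  by rewrite -{1}(mul1g x) (inj_eq (mulIg x)) eq_sym eq_invg1.
by rewrite andbT; case: (_ && _).
Qed.

Lemma difference_set_of_corr v k lambda n D :
    #|gT| = v -> n%:Z = k%:Z - lambda%:Z -> corr D D 1%g = k%:R ->
    (forall g, g != 1%g -> corr D D g = lambda%:R) ->
  difference_set v k lambda n D.
Proof.
move=> cG nkl D1 Dg; split=> //; first by rewrite cardsT.
  by apply/eqP; rewrite -(eqr_nat int) -corr1 D1.
by move=> g g1; apply/eqP; rewrite -(eqr_nat int) card_quotients // Dg.
Qed.

End Evaluation.

(** * Intersections of two affine hyperplanes *)

Section Character.

Variables (F : finFieldType) (chi : F -> int).
Hypothesis chiD : {morph chi : x y / x + y >-> x * y}.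
Hypothesis chi_sq : forall x, chi x * chi x = 1.
Hypothesis chi_nontrivial : exists x, chi x = -1.

Local Notation q := (#|F|%:R : int).

Lemma chi0 : chi 0 = 1.
Proof. by rewrite -(addr0 0) chiD chi_sq. Qed.

Lemma chiN x : chi (- x) = chi x.
Proof.
by rewrite -[LHS]mulr1 -(chi_sq x) mulrA -chiD addNr chi0 mul1r.
Qed.

(** If [a != 0], translating [u] by [a^-1 * x0] with [chi x0 = -1] changes the
    sign of the sum. *)
Lemma sum_chi a : \sum_u chi (a * u) = q * (a == 0)%:R.
Proof.
have [-> | a0] := eqVneq.
  rewrite mulr1 -sum1_card natr_sum; apply: eq_bigr => u _.
  by rewrite mul0r chi0.
rewrite mulr0; have [x0 chix0] := chi_nontrivial; set S := \sum_u _.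
have SN : S = - S.
  rewrite {1}/S (reindex_inj (addrI (a^-1 * x0))) /= -mulN1r -chix0 mulr_sumr.
  by apply: eq_bigr => u _; rewrite mulrDr mulVKf // chiD.
by apply/eqP; rewrite -[_ == 0](@mulrn_eq0 _ S 2) mulr2n {1}SN addNr.
Qed.

Lemma sign_indicator (x e : int) : x * x = 1 -> e * e = 1 ->
  2 * (x == e)%:R = 1 + e * x.
Proof.
move=> /eqP; rewrite -expr2 sqrf_eq1 => xE /eqP.
by rewrite -expr2 sqrf_eq1; case/orP: xE => /eqP-> /orP[] /eqP->.
Qed.

(** Expanding both indicators by [sign_indicator] leaves a constant and three
    character sums.  The first two vanish, and the third, of the character of
    parameter [a1 - a2], survives exactly when the two hyperplanes are
    parallel.  The factor 4 clears the two denominators of the indicators. *)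
Lemma count_fibre a1 a2 t1 t2 e1 e2 :
    a1 != 0 -> a2 != 0 -> e1 * e1 = 1 -> e2 * e2 = 1 ->
  4 * \sum_u (chi (a1 * (t1 + u)) == e1)%:R * (chi (a2 * (t2 + u)) == e2)%:R
  = q * (1 + (a1 == a2)%:R * (e1 * e2 * chi (a1 * (t1 - t2)))).
Proof.
move=> a10 a20 e1sq e2sq; rewrite mulr_sumr.
transitivity (\sum_u (1 + e1 * chi (a1 * t1) * chi (a1 * u)
   + e2 * chi (a2 * t2) * chi (a2 * u)
   + e1 * e2 * chi (a1 * t1) * chi (a2 * t2) * chi ((a1 - a2) * u))).
  apply: eq_bigr => u _.
  rewrite (_ : 4%R = 2%R * 2%R :> int) // mulrACA !sign_indicator //.
  rewrite mulrBl !mulrDr !chiD chiN; ring.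
rewrite !big_split /= -!mulr_sumr !sum_chi (negbTE a10) (negbTE a20).
rewrite sumr_const cardT -cardE subr_eq0 mulrBr chiD chiN.
have [->|_] := eqVneq a1 a2; rewrite ?mulr0 ?mulr1 ?addr0 ?mul0r ?addr0 ?mul1r;
by ring.
Qed.

End Character.

(** * Skew sets in a central extension *)

(** The group [gT] is a central extension of the additive group of [F] by
    itself, with projection [p], section [s] and inclusion [i].  The extension
    need not split: [s] is any map with [p \o s = id]. *)
Section Extension.

Variables (F : finFieldType) (chi : F -> int).
Hypothesis chiD : {morph chi : x y / x + y >-> x * y}.
Hypothesis chi_sq : forall x, chi x * chi x = 1.
Hypothesis chi_nontrivial : exists x, chi x = -1.

Variables (gT : finGroupType) (p : gT -> F) (i s : F -> gT).
Hypothesis pM : {morph p : x y / (x * y)%g >-> x + y}.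
Hypothesis p_s : cancel s p.
Hypothesis p_i : forall u, p (i u) = 0.
Hypothesis i_central : forall u x, (i u * x = x * i u)%g.

(** A choice of origin in each coset of the central subgroup. *)
Definition fibre_coordinate (t : gT -> F) := forall x u, t (x * i u)%g = t x + u.

Variable t : gT -> F.
Hypothesis t_i : fibre_coordinate t.
Hypothesis pt_inj : forall x y, p x = p y -> t x = t y -> x = y.

Local Notation q := (#|F|%:R : int).

Implicit Types (a b c w : F) (e : int) (z : gT).

Lemma p1 : p 1%g = 0.
Proof. by apply: (addrI (p 1%g)); rewrite -pM mulg1 addr0. Qed.

Lemma pV x : p x^-1%g = - p x.
Proof. by apply: (addrI (p x)); rewrite -pM mulgV p1 subrr. Qed.

Lemma p_mul_i x u : p (x * i u)%g = p x.
Proof. by rewrite pM p_i addr0. Qed.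

Lemma iV u : (i u)^-1%g = i (- u).
Proof.
apply/eqP; rewrite eq_invg_mul; apply/eqP/pt_inj.
  by rewrite pM !p_i p1 addr0.
by rewrite t_i -{1}(mul1g (i u)) t_i addrK.
Qed.

Lemma kernel_i z : p z = 0 -> z = i (t z - t 1%g).
Proof.
move=> pz; apply: pt_inj; first by rewrite p_i.
by rewrite -(mul1g (i _)) t_i addrC subrK.
Qed.

Lemma sum_fibres (f : gT -> int) : \sum_x f x = \sum_c \sum_u f (s c * i u)%g.
Proof.
rewrite (partition_big p predT) //=; apply: eq_bigr => c _.
rewrite (reindex (fun u => s c * i u)%g) /=.
  by apply: eq_bigl => u; rewrite p_mul_i p_s eqxx.
exists (fun x => t x - t (s c)) => [u _ | x]; first by rewrite t_i addrC addKr.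
rewrite inE => /eqP px; apply: pt_inj; rewrite ?p_mul_i ?p_s //.
by rewrite t_i addrC subrK.
Qed.

Lemma card_extension : #|gT| = (#|F| * #|F|)%N.
Proof.
apply/eqP; rewrite -(eqr_nat int) natrM -sum1_card natr_sum sum_fibres /=.
by rewrite !sumr_const !cardT -!cardE mulr_natr.
Qed.

(** Both the members of the linking system ([e = 1]) and the difference sets
    that occur in their products ([e = -1], with another coordinate) have this
    shape; [e = -1] takes the complements of the hyperplanes. *)
Definition skew_set a (tau : gT -> F) e : {set gT} :=
  [set x | (p x != 0) && (chi (a * p x * tau x) == e)].

(** The coset over [c] contributes nothing if [c = 0] or [c = p z], since then
    [x] or [z^-1 * x] lies over [0]; elsewhere [count_fibre] applies. *)
Lemma corr_skew_set a1 a2 tau1 tau2 e1 e2 z :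
    a1 != 0 -> a2 != 0 -> fibre_coordinate tau1 -> fibre_coordinate tau2 ->
    e1 * e1 = 1 -> e2 * e2 = 1 ->
  4 * corr (skew_set a1 tau1 e1) (skew_set a2 tau2 e2) z
  = q * \sum_(c | (c != 0) && (c != p z))
      (1 + (a1 * c == a2 * (c - p z))%:R
           * (e1 * e2 * chi (a1 * c * (tau1 (s c) - tau2 (z^-1 * s c)%g)))).
Proof.
move=> a10 a20 tau1i tau2i e1sq e2sq.
rewrite /corr sum_fibres !mulr_sumr [RHS]big_mkcond /=; apply: eq_bigr => c _.
have pc u : p (s c * i u)%g = c by rewrite p_mul_i p_s.
have pzc u : p (z^-1 * (s c * i u))%g = c - p z by rewrite pM pV pc addrC.
have [c0 | c0] /= := eqVneq c 0.
  by rewrite big1 ?mulr0 // => u _; rewrite inE pc c0 eqxx mul0r.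
have [cw | cw] /= := eqVneq c (p z).
  rewrite big1 ?mulr0 // => u _.
  by rewrite [_ \in skew_set a2 _ _]inE pzc cw subrr eqxx mulr0.
rewrite -(count_fibre chiD chi_sq chi_nontrivial _ _ _ _ e1sq e2sq) ?mulf_neq0 //;
  last by rewrite subr_eq0.
congr (_ * _); apply: eq_bigr => u _.
by rewrite !inE pc pzc subr_eq0 c0 cw /= mulgA tau1i tau2i.
Qed.

Lemma sum_nonzero (f : F -> int) : \sum_(c | c != 0) f c = \sum_c f c - f 0.
Proof. by rewrite [in RHS](bigD1 0) //= addrAC subrr add0r. Qed.

Lemma sum1_nonzero : \sum_(c : F | c != 0) 1 = q - 1.
Proof. by rewrite sum_nonzero sumr_const cardT -cardE. Qed.

Lemma sum1_nonzero_neq w : w != 0 ->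
  \sum_(c : F | (c != 0) && (c != w)) 1 = q - 2.
Proof.
move=> w0; have := sum1_nonzero; rewrite (bigD1 w) //= => /(canRL (addKr _))->.
ring.
Qed.

Section Autocorrelation.

Variables (a : F) (tau : gT -> F) (e : int).
Hypotheses (a0 : a != 0) (tau_i : fibre_coordinate tau) (e_sq : e * e = 1).
Local Notation D := (skew_set a tau e).

(** Here the offset is the same element [u0] on every coset, so that the
    offsets sum to the character sum of parameter [a * u0] over the nonzero
    elements of [F]. *)
Lemma autocorr_kernel z : p z = 0 ->
  4 * corr D D z = q * (q - 2 + q * (z == 1%g)%:R).
Proof.
move=> pz0; rewrite corr_skew_set // pz0; congr (_ * _).
rewrite (eq_bigl (fun c => c != 0)) => [|c]; last by rewrite andbb.
have zi := kernel_i pz0; set u0 := t z - t 1%g in zi.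
rewrite (eq_bigr (fun c => 1 + chi ((a * u0) * c))) => [|c c0]; last first.
  rewrite subr0 eqxx mul1r e_sq mul1r zi iV i_central tau_i opprD opprK addrA.
  by rewrite subrr add0r mulrAC.
rewrite big_split /= sum1_nonzero sum_nonzero sum_chi // mulr0 (chi0 chiD chi_sq).
rewrite mulf_eq0 (negbTE a0) /=.
have -> : (u0 == 0) = (z == 1%g).
  apply/eqP/eqP=> [u00|z1]; last by rewrite /u0 z1 subrr.
  apply: pt_inj; first by rewrite pz0 p1.
  by apply/eqP; rewrite -subr_eq0; apply/eqP.
ring.
Qed.

(** The equation [a * c = a * (c - p z)] has no solution [c], so every coset
    makes the generic contribution. *)
Lemma autocorr_off_kernel z : p z != 0 -> 4 * corr D D z = q * (q - 2).
Proof.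
move=> pz0; rewrite corr_skew_set // -(sum1_nonzero_neq pz0); congr (_ * _).
apply: eq_bigr => c _; rewrite (inj_eq (mulfI a0)).
rewrite -[X in X == _]subr0 (inj_eq (addrI c)) eqr_opp eq_sym (negbTE pz0).
by rewrite mul0r addr0.
Qed.

Lemma skew_set_difference_set m : #|F| = (2 * m)%N -> (0 < m)%N ->
  difference_set (4 * m ^ 2) (m * (2 * m - 1)) (m * (m - 1)) (m ^ 2) D.
Proof.
move=> cF m0; have qE : q = 2 * m%:R by rewrite cF natrM.
have k1 : (1 <= 2 * m)%N by rewrite muln_gt0.
have cancel4 (x y : int) : 4 * x = 4 * y -> x = y by apply: mulfI.
apply: difference_set_of_corr.
- by rewrite card_extension cF; ring.
- by rewrite -!natz natrX !natrM !natrB // natrM; ring.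
- apply: cancel4; rewrite autocorr_kernel ?p1 // eqxx qE natrM natrB //.
  by rewrite natrM /=; ring.
- move=> g g1; apply: cancel4; rewrite natrM natrB //.
  have [pg0 | pg0] := eqVneq (p g) 0.
    by rewrite autocorr_kernel // (negbTE g1) qE /=; ring.
  by rewrite autocorr_off_kernel // qE; ring.
Qed.

End Autocorrelation.

Section CrossCorrelation.

Variables (a1 a2 : F).
Hypotheses (a10 : a1 != 0) (a20 : a2 != 0) (a12 : a1 != a2).

(** The cosets on which the hyperplanes of the two sets are parallel: for a
    shift by [z], the only one is over [cross_ratio * p z]. *)
Definition cross_ratio : F := a2 / (a2 - a1).
Definition cross_section z := s (cross_ratio * p z).
(** The offset of the two translates on that coset, as a function of [z]. *)
Definition cross_coordinate z :=
  t (cross_section z) - t (z^-1 * cross_section z)%g.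

Lemma cross_coordinate_i : fibre_coordinate cross_coordinate.
Proof.
move=> x u; rewrite /cross_coordinate /cross_section p_mul_i invMg iV.
rewrite -mulgA i_central t_i; ring.
Qed.

(** The product of two members is determined by one exceptional coset, hence by
    a single sign; its parameter is [a1 * c = a1 * cross_ratio * p z]. *)
Lemma crosscorr z :
  4 * corr (skew_set a1 t 1) (skew_set a2 t 1) z
  = q * (q - 1
      - 2 * (z \in skew_set (a1 * cross_ratio) cross_coordinate (-1))%:R).
Proof.
have a21 : a2 - a1 != 0 by rewrite subr_eq0 eq_sym.
rewrite corr_skew_set ?mulr1 // inE; congr (_ * _).
have solve c w : (a1 * c == a2 * (c - w)) = (c == cross_ratio * w).
  rewrite -subr_eq0 -[in RHS]subr_eq0 -(mulrI_eq0 (c - _) (mulfI a21)) -oppr_eq0.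
  by congr (_ == 0); rewrite /cross_ratio; field.
have [pz0 | pz0] /= := eqVneq (p z) 0.
  rewrite mulr0 subr0 -sum1_nonzero; apply: eq_big => [c | c].
    by rewrite pz0 andbb.
  by move=> /andP[c0 _]; rewrite solve pz0 mulr0 (negbTE c0) mul0r addr0.
set w := p z in pz0 *; pose c0 := cross_ratio * w.
have c00 : c0 != 0 by rewrite !mulf_neq0 ?invr_eq0.
have c0w : c0 != w.
  rewrite -subr_eq0 (_ : _ - w = a1 * w / (a2 - a1)) ?mulf_neq0 ?invr_eq0 //.
  by rewrite /c0 /cross_ratio; field.
rewrite big_split /= sum1_nonzero_neq // (bigD1 c0) ?c00 //=.
rewrite big1 ?addr0; last first.
  by move=> c /andP[_ cc0]; rewrite solve (negbTE cc0) mul0r.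
rewrite solve eqxx !mul1r.
(* A sign is 1 minus twice the indicator of its being -1. *)
rewrite sign_indicator // -/(cross_section z) -/(cross_coordinate z).
by rewrite mulrA; ring.
Qed.

End CrossCorrelation.

Definition link_member a := skew_set a t 1.

(** Equal members would have equal correlations at the identity, but
    [crosscorr] gives q (q - 1) / 4 there, half of the size given by
    [autocorr_kernel]. *)
Lemma link_member_inj a1 a2 : a1 != 0 -> a2 != 0 ->
  link_member a1 = link_member a2 -> a1 = a2.
Proof.
move=> a10 a20 D12; apply/eqP; apply: contraT => a12.
have q1 : (1 < #|F|)%N by rewrite (cardD1 0) (cardD1 a1) !inE a10.
have q0 : q != 0 by rewrite pnatr_eq0 -lt0n (leq_trans _ q1).
have := crosscorr a10 a20 a12 1%g.
rewrite -[skew_set a1 _ _]/(link_member a1) D12 autocorr_kernel ?p1 ?mulr1 //.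
rewrite inE p1 !eqxx /= => /(mulfI q0) qE.
have qE1 : q = 1.
  by apply: (addIr (q - 2)); transitivity (q - 2 + q * 1); [|rewrite qE]; ring.
by move/eqP: qE1; rewrite pnatr_eq1 => /eqP qE1; rewrite qE1 in q1.
Qed.

Definition link_system : {set {set gT}} :=
  [set link_member a | a in [set a | a != 0]].

Lemma link_system_reduced r : #|F| = (4 * r)%N -> (0 < r)%N ->
  reduced_linking_system (4 * (2 * r) ^ 2) (2 * r * (4 * r - 1))
    (2 * r * (2 * r - 1)) ((2 * r) ^ 2) (4 * r - 1) link_system.
Proof.
move=> cF r0; have qE : q = 4 * r%:R by rewrite cF natrM.
have cF2 : #|F| = (2 * (2 * r))%N by rewrite cF mulnA.
have r20 : (0 < 2 * r)%N by rewrite muln_gt0.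
have dsets a tau e : a != 0 -> fibre_coordinate tau -> e * e = 1 ->
  difference_set (4 * (2 * r) ^ 2) (2 * r * (4 * r - 1))
    (2 * r * (2 * r - 1)) ((2 * r) ^ 2) (skew_set a tau e).
  move=> a0 tau_i e_sq; rewrite -[(4 * r)%N](mulnA 2 2 r).
  exact: skew_set_difference_set.
split.
- by rewrite -(prednK r0) mulnS addnC -addnBA // (leq_trans _ (leq_addl _ _)).
- rewrite card_in_imset => [|a1 a2]; last by rewrite !inE; exact: link_member_inj.
  by rewrite cardsE -cF subn1 -(cardC1 0).
- by move=> D /imsetP[a]; rewrite inE => a0 ->; apply: dsets.
(* By [crosscorr] with q = 4 r, the correlation is r (4 r - 1) off the set
   D(i,j) and 2 r less on it; so nu = r (4 r - 1) and mu - nu = - 2 r. *)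
exists (r%:R * (4 * r%:R - 3)), (r%:R * (4 * r%:R - 1)).
move=> D1 D2 /imsetP[a1 + ->] /imsetP[a2 + ->]; rewrite !inE => a10 a20 D12.
have a12 : a1 != a2 by apply: contraNneq D12 => ->.
exists (skew_set (a1 * cross_ratio a1 a2) (cross_coordinate a1 a2) (-1)).
  apply: dsets; rewrite ?mulrNN ?mulr1 //; last exact: cross_coordinate_i.
  by rewrite !mulf_neq0 ?invr_eq0 // subr_eq0 eq_sym.
apply/ffunP=> z; apply: (@mulfI int 4) => //.
rewrite zgset_mulVE crosscorr // [in RHS]ffunE !zgring_mulrzE !zgsetE.
rewrite in_setT qE /=.
ring.
Qed.

(** This forces the extension not to split, and makes inversion move points
    inside the cosets of the central subgroup. *)
Hypothesis square : forall x, (x * x)%g = i (p x).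

(** The inverse of [x] is [x * i (- p x)].  A point with [p x = 1] and [t x = 0]
    lies in every member, and its inverse fails to lie in the member of [a]
    when [chi a = -1]. *)
Lemma link_system_not_reversible :
  exists2 D, D \in link_system & ~ reversible D.
Proof.
have [a chia] := chi_nontrivial.
have a0 : a != 0 by apply: contra_eqN chia => /eqP->; rewrite (chi0 chiD chi_sq).
exists (link_member a); first by apply: imset_f; rewrite inE.
move/ffunP=> rev.
have [x px tx] : exists2 x, p x = 1 & t x = 0.
  by exists (mulg (s 1) (i (- t (s 1)))); rewrite ?p_mul_i ?p_s // t_i subrr.
have xV : x^-1%g = (x * i (- 1)%R)%g.
  by rewrite -iV -px -square invMg mulKVg.
have := rev x; rewrite zgsetE zgsetVE xV !inE p_mul_i px t_i tx oner_eq0 /=.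
rewrite mulr0 sub0r mulr1 mulrN1 (chiN chiD chi_sq) (chi0 chiD chi_sq) chia.
by [].
Qed.

End Extension.

(** * Coordinates on Z_4^n *)

(** The additive group of GF(2^n) is a vector space of dimension n over
    the prime field.  *)
Lemma additive_coordinates n : (0 < n)%N ->
  {F : finFieldType & #|F| = (2 ^ n)%N &
     {phi : F -> 'rV['F_2]_n | {morph phi : x y / x + y} & bijective phi}}.
Proof.
move=> n0; have [F chF cF] := @pPrimePowerField 2 n isT n0.
exists F => //.
have [phi phi_linear phi_bij] := pprimeChar_vectAxiom chF.
have dimF : logn 2 #|pPrimeCharType chF| = n by rewrite cF pfactorK.
move: phi phi_linear phi_bij; rewrite dimF => phi phi_linear phi_bij.
by exists phi => // x y; have := phi_linear 1 x y; rewrite !scale1r.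
Qed.

(** The two binary digits of an element of Z/4, and the two ways in which a
    binary digit gives an element of Z/4: as a representative of its class
    modulo 2, and through the isomorphism of Z/2 with 2Z/4. *)
Definition low (a : 'Z_4) : 'F_2 := inZp a.
Definition high (a : 'Z_4) : 'F_2 := inZp a./2.
Definition lift (u : 'F_2) : 'Z_4 := inZp u.
Definition double (u : 'F_2) : 'Z_4 := inZp u.*2.

Lemma Z4_all (P : 'Z_4 -> Prop) : P 0 -> P 1 -> P 2 -> P 3 -> forall a, P a.
Proof.
move=> P0 P1 P2 P3 [[|[|[|[|//]]]] lta].
- by rewrite (_ : Ordinal lta = 0) //; apply: val_inj.
- by rewrite (_ : Ordinal lta = 1) //; apply: val_inj.
- by rewrite (_ : Ordinal lta = 2) //; apply: val_inj.
- by rewrite (_ : Ordinal lta = 3) //; apply: val_inj.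
Qed.

Lemma F2_all (P : 'F_2 -> Prop) : P 0 -> P 1 -> forall u, P u.
Proof.
move=> P0 P1 [[|[|//]] ltu].
- by rewrite (_ : Ordinal ltu = 0) //; apply: val_inj.
- by rewrite (_ : Ordinal ltu = 1) //; apply: val_inj.
Qed.

Lemma lowD : {morph low : a b / a + b}.
Proof. by move=> a b; apply/eqP; move: a b; do 2!apply: Z4_all. Qed.

(** Adding an even element creates no carry, so although [high] is not additive
    it is a translation along the cosets of 2Z/4. *)
Lemma high_double a u : high (a + double u) = high a + u.
Proof. by apply/eqP; move: a u; apply: Z4_all; apply: F2_all. Qed.

Lemma low_double u : low (double u) = 0.
Proof. by apply/eqP; move: u; apply: F2_all. Qed.

Lemma lowK : cancel lift low.
Proof. by move=> u; apply/eqP; move: u; apply: F2_all. Qed.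

Lemma double_low a : double (low a) = a + a.
Proof. by apply/eqP; move: a; apply: Z4_all. Qed.

Lemma low_high_inj a b : low a = low b -> high a = high b -> a = b.
Proof.
have E c : c = lift (low c) + double (high c).
  by apply/eqP; move: c; apply: Z4_all.
by move=> lo hi; rewrite (E a) (E b) lo hi.
Qed.

(* The matrix type 'rV['Z_4]_d.+1 carries its additive group structure, so this
   is the group Z_4^(d+1). *)
Theorem corollary5p11 (d : nat) (hd : (0 < d)%N) :
  exists L : {set {set 'rV['Z_4]_d.+1}},
    reduced_linking_system
      (2 ^ (2 * d + 2))%N
      (2 ^ d * (2 ^ (d + 1) - 1))%N
      (2 ^ d * (2 ^ d - 1))%N
      (2 ^ (2 * d))%N
      (2 ^ (d + 1) - 1)%N
      L
    /\ exists2 D, D \in L & ~ reversible D.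
Proof.
have [F cF [phi phiD [psi phiK psiK]]] := additive_coordinates (ltn0Sn d).
have psiD : {morph psi : x y / x + y}.
  by move=> x y; apply: (can_inj phiK); rewrite phiD !psiK.
have phi0 : phi 0 = 0 by apply: (addrI (phi 0)); rewrite -phiD !addr0.
have psi0 : psi 0 = 0 by rewrite -phi0 phiK.
pose chi x : int := (-1) ^+ (phi x 0 0 : 'F_2).
pose p (x : 'rV['Z_4]_d.+1) := psi (map_mx low x).
pose t (x : 'rV['Z_4]_d.+1) := psi (map_mx high x).
pose i x : 'rV['Z_4]_d.+1 := map_mx double (phi x).
pose s x : 'rV['Z_4]_d.+1 := map_mx lift (phi x).
have chiD : {morph chi : x y / x + y >-> x * y}.
  move=> x y; rewrite /chi phiD mxE; apply/eqP.
  by move: (phi x 0 0) (phi y 0 0); do 2!apply: F2_all.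
have chi_sq x : chi x * chi x = 1 by rewrite -expr2 sqrr_sign.
have chi_nt : exists x, chi x = -1.
  by exists (psi (const_mx 1)); rewrite /chi psiK mxE.
have pM : {morph p : x y / (x * y)%g >-> x + y}.
  move=> x y; rewrite /p -psiD; congr psi.
  by apply/rowP=> k; rewrite !mxE lowD.
have p_s : cancel s p.
  move=> c; rewrite /p /s -[RHS]phiK; congr psi.
  by apply/rowP=> k; rewrite !mxE lowK.
have p_i u : p (i u) = 0.
  by rewrite -psi0; congr psi; apply/rowP=> k; rewrite !mxE low_double.
have i_central u x : (i u * x = x * i u)%g by apply: addrC.
have t_i : fibre_coordinate i t.
  move=> x u; rewrite /t -{2}(phiK u) -psiD; congr psi.
  by apply/rowP=> k; rewrite !mxE high_double.
have pt_inj x y : p x = p y -> t x = t y -> x = y.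
  move=> /(can_inj psiK)/rowP pxy /(can_inj psiK)/rowP txy.
  apply/rowP=> k; move: (pxy k) (txy k); rewrite !mxE.
  exact: low_high_inj.
have square x : (x * x)%g = i (p x).
  by rewrite /i psiK; apply/rowP=> k; rewrite !mxE double_low.
exists (link_system chi p t); split; last first.
  exact: link_system_not_reversible square.
(* In terms of r = 2 ^ (d - 1) the field has 4 r elements. *)
have half2d : (2 * 2 ^ d.-1 = 2 ^ d)%N by rewrite -expnS prednK.
have quarter : (4 * 2 ^ d.-1 = 2 ^ (d + 1))%N.
  by rewrite -(mulnA 2 2) half2d addn1 expnS.
have sq : ((2 ^ d) ^ 2 = 2 ^ (2 * d))%N by rewrite -expnM mulnC.
have order : (4 * 2 ^ (2 * d) = 2 ^ (2 * d + 2))%N.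
  by rewrite addn2 !expnS mulnA.
rewrite -order -sq -quarter -half2d.
apply: (link_system_reduced chiD chi_sq chi_nt pM p_s p_i i_central t_i pt_inj
  (r := (2 ^ d.-1)%N)).
  by rewrite cF quarter addn1.
by rewrite expn_gt0.
Qed.
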